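(* Let $\alpha\in[0,1]$ be given and consider the problem $$\max_{\mathbf w,\ \mathcal R}\ \mathcal R\quad\text{s.t.}\quad \mathcal R_{\rm s}\ge\alpha\mathcal R,\quad \mathcal R_{\rm c}\ge(1-\alpha)\mathcal R,\quad \lVert\mathbf w\rVert^2=1,\qquad(\ast)$$ over $\mathbf w\in\mathbb C^{M\times1}$ and real $\mathcal R$, where $\mathcal R_{\rm c}=\log_2(1+p|\mathbf w^{\mathsf H}\mathbf h_{\rm c}|^2)$ and $\mathcal R_{\rm s}=L^{-1}\log_2(1+pNL\alpha_{\rm s}|\mathbf w^{\mathsf H}\mathbf h_{\rm s}|^2)$. Denote $\beta_1=(1-\alpha)\ln2$, $\beta_2=L\alpha\ln2$, $\mathbf h_1=\sqrt p\,\mathbf h_{\rm c}$, $\mathbf h_2=\sqrt{pNL\alpha_{\rm s}}\,\mathbf h_{\rm s}$, $\alpha_{11}=p\lVert\mathbf h_{\rm c}\rVert^2$, $\alpha_{22}=pNL\alpha_{\rm s}\lVert\mathbf h_{\rm s}\rVert^2$, $\alpha_{12}=p\sqrt{NL\alpha_{\rm s}}\,\mathbf h_{\rm c}^{\mathsf H}\mathbf h_{\rm s}$, $$\delta=\sqrt{\frac{e^{\beta_2\mathcal R}-1}{e^{\beta_1\mathcal R}-1}},\quad \varrho_1=\alpha_{22}-\delta|\alpha_{12}|,\quad \varrho_2=\alpha_{11}-\delta^{-1}|\alpha_{12}|,\quad \chi=\varrho_1\beta_1e^{\beta_1\mathcal R}+\varrho_2\beta_2e^{\beta_2\mathcal R},\quad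 \mu_1=\frac{\varrho_1}{\chi},\quad \mu_2=\frac{\varrho_2}{\chi}.$$ Let $\mathcal R^\star$ denote the solution of $\mathcal R$ to the equation $$\alpha_{11}\alpha_{22}-|\alpha_{12}|^2=(\alpha_{11}-\delta^{-1}|\alpha_{12}|)(e^{\beta_2\mathcal R}-1)+(\alpha_{22}-\delta|\alpha_{12}|)(e^{\beta_1\mathcal R}-1).$$ Then the optimal beamforming vector in problem $(\ast)$ is given by $$\mathbf w_\alpha^\star=\begin{cases}\mathbf w_{\rm c}, & \mu_2=0,\ \mu_1>0,\\[2pt] \tau\mu_1\,(e^{\beta_1\mathcal R}-1)^{1/2}\,\mathbf h_1+\tau\mu_2\,(e^{\beta_2\mathcal R}-1)^{1/2}\,\mathbf h_2\,e^{-\mathrm j\angle\alpha_{12}}, & \mu_1>0,\ \mu_2>0,\\[2pt] \mathbf w_{\rm s}, & \mu_1=0,\ \mu_2>0,\end{cases}$$ where $\mathcal R$ (in $\delta$, $\chi$ and the formula) is set to $\mathcal R=\mathcal R^\star$, $\tau$ is a normalization constant (making $\lVert\mathbf w_\alpha^\star\rVert=1$), $\mathbf w_{\rm c}=\lVert\mathbf h_{\rm c}\rVert^{-1}\mathbf h_{\rm c}$ and $\mathbf w_{\rm s}=\lVert\mathbf h_{\rm s}\rVert^{-1}\mathbf h_{\rm s}$.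
   Context: A base station with $M$ transmit and $N$ receive antennas, power budget $p>0$ and frame length $L$ uses a unit-norm beamforming vector $\mathbf w\in\mathbb C^{M\times1}$ to serve a single-antenna communication user and simultaneously sense a single target. $\mathbf h_{\rm c}\in\mathbb C^{M\times1}$ is the (known) communication channel and $\mathbf h_{\rm s}\in\mathbb C^{M\times1}$ is the transmit array steering vector toward the target (the sensing channel); both are nonzero. $\alpha_{\rm s}>0$ is the average strength of the target's reflection coefficient. $\mathcal R_{\rm c}$ is the communication rate and $\mathcal R_{\rm s}$ the sensing rate. The number $\alpha\in[0,1]$ is a rate-profile parameter; letting it vary from $0$ to $1$ in problem $(\ast)$ yields the entire Pareto boundary of the sensing-rate/communication-rate region. $\angle z$ denotes the argument of the complex number $z$, $\mathrm j$ the imaginary unit, and $(\cdot)^{\mathsf H}$ the conjugate transpose. *)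

(* Defs.v *)
From HB Require Import structures.
From mathcomp Require Import all_boot all_order all_algebra.
From mathcomp Require Import complex.
From mathcomp Require Import reals sequences exp trigo.

Set Implicit Arguments.
Unset Strict Implicit.
Unset Printing Implicit Defensive.

Import Order.TTheory GRing.Theory Num.Theory.
Local Open Scope ring_scope.
Local Open Scope complex_scope.
Local Open Scope sesquilinear_scope.

Definition log2 (R : realType) (x : R) : R := ln x / ln 2.

(* The real-valued modulus; [`|z|] itself lives in R[i]. *)
Definition cmod (R : realType) (z : R[i]) : R := ComplexField.Normc.normc z.

Definition expi (R : realType) (t : R) : R[i] := cos t +i* sin t.

(* [t] is a determination of the argument of [z]; every real [t] is an argument
   of 0. *)
Definition is_arg (R : realType) (t : R) (z : R[i]) : Prop :=
  z = (cmod z)%:C * expi t.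

Definition hdot (R : realType) (M : nat) (u v : 'cV[R[i]]_M) : R[i] :=
  (u^t* *m v) 0 0.

Definition vnorm (R : realType) (M : nat) (v : 'cV[R[i]]_M) : R :=
  Num.sqrt (\sum_(i < M) cmod (v i 0) ^+ 2).

Definition comm_rate (R : realType) (M : nat) (p : R) (hc w : 'cV[R[i]]_M) : R :=
  log2 (1 + p * cmod (hdot w hc) ^+ 2).

Definition sens_rate (R : realType) (M N L : nat) (p alphas : R)
    (hs w : 'cV[R[i]]_M) : R :=
  L%:R^-1 * log2 (1 + p * N%:R * L%:R * alphas * cmod (hdot w hs) ^+ 2).

Definition feasible (R : realType) (M N L : nat) (p alphas : R)
    (hc hs : 'cV[R[i]]_M) (alpha : R) (w : 'cV[R[i]]_M) (r : R) : Prop :=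
  [/\ sens_rate N L p alphas hs w >= alpha * r,
      comm_rate p hc w >= (1 - alpha) * r
    & vnorm w ^+ 2 = 1].

Definition optimal_beam (R : realType) (M N L : nat) (p alphas : R)
    (hc hs : 'cV[R[i]]_M) (alpha : R) (w : 'cV[R[i]]_M) : Prop :=
  exists2 r : R, feasible N L p alphas hc hs alpha w r
    & forall (w' : 'cV[R[i]]_M) (r' : R),
        feasible N L p alphas hc hs alpha w' r' -> r' <= r.

(* Main.v *)
(** After exponentiation the rate constraints read |w^H h_i|^2 >= s_i(R)^2 with
    s_i(R) = sqrt (e^(beta_i R) - 1).  Write A, B, C for |h_1|^2, |h_2|^2,
    |h_1^H h_2|, D = A B - C^2, c_1 = rho_1 s_1 = B s_1 - C s_2 and
    c_2 = rho_2 s_2 = A s_2 - C s_1; the equation for R* is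
    c_1 s_1 + c_2 s_2 = D.  The phase-aligned combination v of h_1, h_2 with
    weights c_1, c_2 has |v| = D and, once normalised, gains exactly s_1, s_2.
    Conversely, for unit w, Cauchy-Schwarz (after aligning phases) gives
    c_1 |w^H h_1| + c_2 |w^H h_2| <= |v| = D, so the gains cannot both exceed
    s_1, s_2 and no R > R* is feasible.  Nonnegativity of mu_1, mu_2 forces
    R* > 0 and D > 0, again by Cauchy-Schwarz.  For alpha = 0 or 1 the formula
    degenerates to a single matched beam, although R* is then not the optimal
    value in general. *)
Require Import Defs.
From HB Require Import structures.
From mathcomp Require Import all_boot all_order all_algebra.
From mathcomp Require Import complex.
From mathcomp Require Import reals sequences exp trigo.
From mathcomp Require Import ring lra.

Set Implicit Arguments.
Unset Strict Implicit.
Unset Printing Implicit Defensive.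

Import Order.TTheory GRing.Theory Num.Theory.
Local Open Scope ring_scope.
Local Open Scope complex_scope.

(** * Modulus and phase of complex numbers *)

Lemma realCM (R : realType) (x y : R) : (x * y)%:C = x%:C * y%:C.
Proof. exact: rmorphM. Qed.

Lemma realCN (R : realType) (x : R) : (- x)%:C = - x%:C.
Proof. exact: rmorphN. Qed.

Lemma cmodE (R : realType) (z : R[i]) : (cmod z)%:C = `|z|.
Proof. by []. Qed.

Lemma cmod_ge0 (R : realType) (z : R[i]) : 0 <= cmod z.
Proof. by rewrite -ler0c cmodE. Qed.

Lemma cmodM (R : realType) (x y : R[i]) : cmod (x * y) = cmod x * cmod y.
Proof. exact: ComplexField.Normc.normcM. Qed.

Lemma cmod0 (R : realType) : cmod (0 : R[i]) = 0.
Proof. exact: ComplexField.Normc.normc0. Qed.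

Lemma cmodR (R : realType) (x : R) : cmod x%:C = `|x|.
Proof. by rewrite /cmod /= expr0n addr0 sqrtr_sqr. Qed.

Lemma conjR (R : realType) (x : R) : Num.conj x%:C = x%:C :> R[i].
Proof. exact: conjc_real. Qed.

Lemma cmod_sqr (R : realType) (z : R[i]) : (cmod z ^+ 2)%:C = z * Num.conj z.
Proof. by rewrite rmorphXn /= cmodE normCK. Qed.

Lemma cmod_conj (R : realType) (z : R[i]) : cmod (Num.conj z) = cmod z.
Proof. by apply: complexI; rewrite !cmodE norm_conjC. Qed.

Lemma Re_le_cmod (R : realType) (z : R[i]) : complex.Re z <= cmod z.
Proof.
apply: le_trans (ler_norm _) _.
by rewrite -lecR cmodE normc_ge_Re.
Qed.

Lemma cmod_expi (R : realType) (t : R) : cmod (expi t) = 1.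
Proof. by rewrite /cmod /expi /= cos2Dsin2 sqrtr1. Qed.

Lemma conj_expi (R : realType) (t : R) : Num.conj (expi t) = expi (- t).
Proof. by rewrite /expi cosN sinN. Qed.

Lemma expiNM (R : realType) (t : R) : expi (- t) * expi t = 1.
Proof.
by rewrite mulrC -conj_expi -cmod_sqr cmod_expi expr1n.
Qed.

(** Supplies the unit factors by which the phases of two inner products get aligned; at z = 0 the
    arbitrary choice is u = 1. *)
Lemma polar (R : realType) (z : R[i]) :
  exists2 u : R[i], cmod u = 1 & z = (cmod z)%:C * u.
Proof.
have [->|z0] := eqVneq z 0.
  by exists 1; [exact: ComplexField.Normc.normc1|rewrite cmod0 mul0r].
have nz0 : cmod z != 0.
  by apply: contra_neq z0 => /ComplexField.Normc.eq0_normc.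
exists (z * ((cmod z)^-1)%:C).
  by rewrite cmodM cmodR ger0_norm ?invr_ge0 ?cmod_ge0// divff.
by rewrite mulrCA -rmorphM/= divff// mulr1.
Qed.

(** * Hermitian product, norm and Cauchy-Schwarz *)

Lemma hdotE (R : realType) (M : nat) (u v : 'cV[R[i]]_M) :
  hdot u v = \sum_i Num.conj (u i 0) * v i 0.
Proof. by rewrite /hdot mxE; apply: eq_bigr => i _; rewrite !mxE. Qed.

Lemma hdotDr (R : realType) (M : nat) (u v w : 'cV[R[i]]_M) :
  hdot u (v + w) = hdot u v + hdot u w.
Proof. by rewrite /hdot mulmxDr mxE. Qed.

Lemma hdotZr (R : realType) (M : nat) (a : R[i]) (u v : 'cV[R[i]]_M) :
  hdot u (a *: v) = a * hdot u v.
Proof. by rewrite /hdot -scalemxAr mxE. Qed.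

Lemma hdotC (R : realType) (M : nat) (u v : 'cV[R[i]]_M) :
  hdot u v = Num.conj (hdot v u).
Proof.
rewrite !hdotE rmorph_sum; apply: eq_bigr => i _.
by rewrite rmorphM/= conjCK mulrC.
Qed.

Lemma hdotDl (R : realType) (M : nat) (u v w : 'cV[R[i]]_M) :
  hdot (u + v) w = hdot u w + hdot v w.
Proof. by rewrite hdotC hdotDr rmorphD/= -!hdotC. Qed.

Lemma hdotZl (R : realType) (M : nat) (a : R[i]) (u v : 'cV[R[i]]_M) :
  hdot (a *: u) v = Num.conj a * hdot u v.
Proof. by rewrite hdotC hdotZr rmorphM/= -hdotC. Qed.

Lemma vnorm_ge0 (R : realType) (M : nat) (v : 'cV[R[i]]_M) : 0 <= vnorm v.
Proof. exact: sqrtr_ge0. Qed.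

Lemma vnorm_sqr (R : realType) (M : nat) (v : 'cV[R[i]]_M) :
  vnorm v ^+ 2 = \sum_i cmod (v i 0) ^+ 2.
Proof. by rewrite sqr_sqrtr// sumr_ge0// => i _; exact: sqr_ge0. Qed.

Lemma hdotvv (R : realType) (M : nat) (v : 'cV[R[i]]_M) :
  hdot v v = (vnorm v ^+ 2)%:C.
Proof.
rewrite vnorm_sqr hdotE rmorph_sum; apply: eq_bigr => i _.
by rewrite /= cmod_sqr mulrC.
Qed.

Lemma vnorm_gt0 (R : realType) (M : nat) (v : 'cV[R[i]]_M) :
  v != 0 -> 0 < vnorm v.
Proof.
move=> v0; rewrite lt_def vnorm_ge0 andbT; apply: contra_neq v0 => n0.
have /eqP : vnorm v ^+ 2 = 0 by rewrite n0 expr0n.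
rewrite vnorm_sqr psumr_eq0 => [/allP z0|i _]; last exact: sqr_ge0.
apply/matrixP => i j; rewrite ord1 mxE.
have := z0 i (mem_index_enum _); rewrite /= expf_eq0/= => /eqP.
exact: ComplexField.Normc.eq0_normc.
Qed.

(** Expanding the inner product of the combination with itself leaves two cross terms that are
    conjugate to each other, hence add up to twice a real part. *)
Lemma vnorm_lin (R : realType) (M : nat) (a b : R[i]) (u v : 'cV[R[i]]_M) :
  vnorm (a *: u + b *: v) ^+ 2 = cmod a ^+ 2 * vnorm u ^+ 2
    + cmod b ^+ 2 * vnorm v ^+ 2 + 2 * complex.Re (Num.conj a * b * hdot u v).
Proof.
apply: complexI; rewrite -hdotvv !(hdotDr, hdotDl, hdotZr, hdotZl) !rmorphD/=.
rewrite (realCM (cmod a ^+ 2)) (realCM (cmod b ^+ 2)) (realCM 2).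
rewrite -!hdotvv !cmod_sqr.
have -> : (2 : R)%:C * (complex.Re (Num.conj a * b * hdot u v))%:C
   = (Num.conj a * b * hdot u v) + Num.conj (Num.conj a * b * hdot u v).
  by rewrite (addcJ (_ * _ * _)) rmorph_nat.
rewrite !rmorphM/= conjCK -hdotC.
ring.
Qed.

Lemma vnormZ (R : realType) (M : nat) (a : R[i]) (v : 'cV[R[i]]_M) :
  vnorm (a *: v) = cmod a * vnorm v.
Proof.
apply/eqP; rewrite -(@eqrXn2 _ 2) ?mulr_ge0 ?cmod_ge0 ?vnorm_ge0//; apply/eqP.
have := vnorm_lin a 0 v 0; rewrite scale0r addr0 => ->.
by rewrite exprMn mulr0 mul0r cmod0 expr0n mul0r !addr0 mulr0 addr0.
Qed.

Lemma hdot0l (R : realType) (M : nat) (v : 'cV[R[i]]_M) : hdot 0 v = 0.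
Proof. by rewrite -(scale0r 0) hdotZl rmorph0 mul0r. Qed.

(** With n = |u|^2, the vector n v - (u^H v) u has squared norm n (n |v|^2 - |u^H v|^2), which is
    nonnegative; divide by n. *)
Lemma cauchy_schwarz (R : realType) (M : nat) (u v : 'cV[R[i]]_M) :
  cmod (hdot u v) ^+ 2 <= vnorm u ^+ 2 * vnorm v ^+ 2.
Proof.
have [->|u0] := eqVneq u 0.
  by rewrite hdot0l cmod0 expr0n mulr_ge0 ?exprn_ge0 ?vnorm_ge0.
have n0 : 0 < vnorm u ^+ 2 by rewrite exprn_gt0// vnorm_gt0.
have reE : Num.conj (vnorm u ^+ 2)%:C * (- hdot u v) * hdot v u =
    (- (vnorm u ^+ 2 * cmod (hdot u v) ^+ 2))%:C.
  by rewrite conjR realCN realCM cmod_sqr (hdotC v u); ring.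
have := sqr_ge0 (vnorm ((vnorm u ^+ 2)%:C *: v + (- hdot u v) *: u)).
rewrite vnorm_lin reE cmodR ger0_norm; last exact: ltW.
have -> : cmod (- hdot u v) = cmod (hdot u v).
  by rewrite -mulN1r -realCN cmodM cmodR normrN1 mul1r.
rewrite [complex.Re _]/=.
move: n0; set n := vnorm u ^+ 2; set d := cmod _ ^+ 2; set m := vnorm v ^+ 2.
move=> n0 h; rewrite -(ler_pM2l n0); lra.
Qed.

(** Cauchy-Schwarz for [w] against the combination [z] whose phases make both terms of w^H z
    nonnegative reals; in |z|^2 the real part of the cross term is bounded by its modulus. *)
Lemma unit_hdot_combination_le (R : realType) (M : nat) (u v w : 'cV[R[i]]_M)
    (a b : R) : vnorm w ^+ 2 = 1 -> 0 <= a -> 0 <= b ->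
  (a * cmod (hdot w u) + b * cmod (hdot w v)) ^+ 2 <=
    a ^+ 2 * vnorm u ^+ 2 + b ^+ 2 * vnorm v ^+ 2
    + 2 * (a * b * cmod (hdot u v)).
Proof.
move=> w1 a0 b0.
have [x x1 hx] := polar (hdot w u); have [y y1 hy] := polar (hdot w v).
pose z := (a%:C * Num.conj x) *: u + (b%:C * Num.conj y) *: v.
have unit_conj (t : R[i]) : cmod t = 1 -> t * Num.conj t = 1.
  by move=> t1; rewrite -cmod_sqr t1 expr1n.
have wz : hdot w z = (a * cmod (hdot w u) + b * cmod (hdot w v))%:C.
  rewrite /z hdotDr !hdotZr {1}hx {1}hy rmorphD/= !rmorphM/=.
  rewrite -!mulrA; congr (_ * _ + _ * _); rewrite mulrCA [Num.conj _ * _]mulrC.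
    by rewrite (unit_conj x x1) mulr1.
  by rewrite (unit_conj y y1) mulr1.
have := cauchy_schwarz w z; rewrite w1 mul1r wz cmodR real_normK ?num_real//.
move=> /le_trans; apply; rewrite /z vnorm_lin !cmodM !cmodR !cmod_conj x1 y1.
rewrite !mulr1 !ger0_norm// lerD2l ler_pM2l//.
apply: le_trans (Re_le_cmod _) _.
by rewrite !cmodM !cmod_conj !cmodM !cmodR !cmod_conj x1 y1 !mulr1 !ger0_norm.
Qed.

(** * Normalised beams and the problem in terms of channel gains *)

Lemma normalize_scale (R : realType) (M : nat) (k : R) (h : 'cV[R[i]]_M) :
  0 < k ->
  ((vnorm (k%:C *: h))^-1)%:C *: (k%:C *: h) = ((vnorm h)^-1)%:C *: h.
Proof.
move=> k0; rewrite vnormZ cmodR gtr0_norm// scalerA -realCM invfM.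
by rewrite mulrAC mulVf ?mul1r// gt_eqF.
Qed.

Lemma vnorm_normalize (R : realType) (M : nat) (v : 'cV[R[i]]_M) :
  0 < vnorm v -> vnorm (((vnorm v)^-1)%:C *: v) = 1.
Proof.
by move=> v0; rewrite vnormZ cmodR gtr0_norm ?invr_gt0// mulVf// gt_eqF.
Qed.

(* The rate constraints in exponentiated form, symmetric in the two channels. *)
Definition gain_feasible (R : realType) (M : nat) (b1 b2 : R)
    (h1 h2 w : 'cV[R[i]]_M) (r : R) : Prop :=
  [/\ expR (b1 * r) - 1 <= cmod (hdot w h1) ^+ 2,
      expR (b2 * r) - 1 <= cmod (hdot w h2) ^+ 2
    & vnorm w ^+ 2 = 1].

Definition gain_optimal (R : realType) (M : nat) (b1 b2 : R)
    (h1 h2 w : 'cV[R[i]]_M) : Prop :=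
  exists2 r : R, gain_feasible b1 b2 h1 h2 w r
    & forall w' r', gain_feasible b1 b2 h1 h2 w' r' -> r' <= r.

(** Reduces the pure sensing end, where the first exponent vanishes, to the pure communication
    end. *)
Lemma gain_optimalC (R : realType) (M : nat) (b1 b2 : R)
    (h1 h2 w : 'cV[R[i]]_M) :
  gain_optimal b1 b2 h1 h2 w -> gain_optimal b2 b1 h2 h1 w.
Proof.
move=> [r [f1 f2 w1] ub]; exists r; first by split.
by move=> w' r' [g1 g2 w'1]; apply: (ub w'); split.
Qed.

Lemma log2_ge (R : realType) (a r x : R) : 0 <= x ->
  (a * r <= log2 (1 + x)) = (expR (a * ln 2 * r) - 1 <= x).
Proof.
move=> x0; have l2 : 0 < ln 2 :> R by rewrite ln_gt0// ltr1n.
have x1 : 1 + x \is Num.pos by rewrite posrE ltr_wpDr.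
by rewrite /log2 ler_pdivlMr// mulrAC -ler_expR lnK// lerBlDl.
Qed.

(** Square roots of the power factors are absorbed into the channels, and the factor 1/L of the
    sensing rate moves into the second exponent; the rest is monotonicity of the logarithm. *)
Lemma feasibleE (R : realType) (M N L : nat) (p alphas alpha : R)
    (hc hs w : 'cV[R[i]]_M) (r : R) :
  0 < p -> (0 < L)%N -> 0 <= alphas ->
  feasible N L p alphas hc hs alpha w r <->
  gain_feasible ((1 - alpha) * ln 2) (L%:R * alpha * ln 2)
    ((Num.sqrt p)%:C *: hc) ((Num.sqrt (p * N%:R * L%:R * alphas))%:C *: hs)
    w r.
Proof.
move=> p0 L0 s0; have q0 : 0 <= p * N%:R * L%:R * alphas.
  by rewrite !mulr_ge0 ?ler0n ?(ltW p0).
have L0' : 0 < L%:R :> R by rewrite ltr0n.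
rewrite /feasible /gain_feasible /sens_rate /comm_rate !hdotZr !cmodM !cmodR.
rewrite !exprMn !real_normK ?num_real// (sqr_sqrtr q0) (sqr_sqrtr (ltW p0)).
rewrite -!log2_ge ?mulr_ge0 ?exprn_ge0 ?cmod_ge0 ?(ltW p0) ?ler0n//.
rewrite ler_pdivlMl// mulrA.
by split=> -[].
Qed.

Lemma optimal_beamP (R : realType) (M N L : nat) (p alphas alpha : R)
    (hc hs w : 'cV[R[i]]_M) :
  0 < p -> (0 < L)%N -> 0 <= alphas ->
  gain_optimal ((1 - alpha) * ln 2) (L%:R * alpha * ln 2)
    ((Num.sqrt p)%:C *: hc) ((Num.sqrt (p * N%:R * L%:R * alphas))%:C *: hs)
    w ->
  optimal_beam N L p alphas hc hs alpha w.
Proof.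
move=> p0 L0 s0 [r f ub]; exists r; first exact/feasibleE.
by move=> w' r' /feasibleE f'; apply: (ub w'); exact: f'.
Qed.

(** * Sufficient conditions for optimality *)

(** A zero exponent makes the second constraint vacuous, so only the gain on [h1] matters, and
    Cauchy-Schwarz caps it at |h1|. *)
Lemma gain_optimal_matched (R : realType) (M : nat) (b : R)
    (h1 h2 w : 'cV[R[i]]_M) :
  0 < b -> vnorm w = 1 -> cmod (hdot w h1) = vnorm h1 ->
  gain_optimal b 0 h1 h2 w.
Proof.
move=> b0 w1 wh; have h0 : 0 <= vnorm h1 ^+ 2 by rewrite sqr_ge0.
have hpos : 1 + vnorm h1 ^+ 2 \is Num.pos by rewrite posrE ltr_wpDr.
exists (ln (1 + vnorm h1 ^+ 2) / b).
  split; last by rewrite w1 expr1n.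
    by rewrite mulrCA divff ?gt_eqF// mulr1 lnK// wh lerBlDl.
  by rewrite mul0r expR0 subrr sqr_ge0.
move=> w' r' [f1 _ w'1]; rewrite ler_pdivlMr// mulrC -ler_expR lnK//.
rewrite -lerBlDl; apply: le_trans f1 _.
by have := cauchy_schwarz w' h1; rewrite w'1 mul1r.
Qed.

Lemma hdot_normalize (R : realType) (M : nat) (h : 'cV[R[i]]_M) :
  0 < vnorm h -> cmod (hdot (((vnorm h)^-1)%:C *: h) h) = vnorm h.
Proof.
move=> h0; rewrite hdotZl cmodM cmod_conj hdotvv !cmodR.
by rewrite !ger0_norm ?invr_ge0 ?sqr_ge0 ?ltW// expr2 mulKf// gt_eqF.
Qed.

(** The weights [c1], [c2] act as a dual certificate: a larger rate would push both gains strictly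
    above [s1], [s2], and so their weighted sum above the bound of [unit_hdot_combination_le]. *)
Lemma gain_optimal_of_dual (R : realType) (M : nat) (b1 b2 s1 s2 c1 c2 r : R)
    (h1 h2 w : 'cV[R[i]]_M) :
  0 < b1 -> 0 < b2 -> 0 < s1 -> 0 < s2 -> 0 <= c1 -> 0 <= c2 -> 0 < c1 + c2 ->
  expR (b1 * r) - 1 = s1 ^+ 2 -> expR (b2 * r) - 1 = s2 ^+ 2 ->
  c1 ^+ 2 * vnorm h1 ^+ 2 + c2 ^+ 2 * vnorm h2 ^+ 2
    + 2 * (c1 * c2 * cmod (hdot h1 h2)) = (c1 * s1 + c2 * s2) ^+ 2 ->
  vnorm w = 1 -> cmod (hdot w h1) = s1 -> cmod (hdot w h2) = s2 ->
  gain_optimal b1 b2 h1 h2 w.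
Proof.
move=> b10 b20 s10 s20 c10 c20 c0 E1 E2 dual w1 w_h1 w_h2; exists r.
  by split; rewrite ?w1 ?expr1n ?E1 ?E2 ?w_h1 ?w_h2.
move=> w' r' [f1 f2 w'1]; rewrite leNgt; apply/negP => rr'.
have lt1 : s1 < cmod (hdot w' h1).
  rewrite -(@ltr_pXn2r _ 2) ?nnegrE ?cmod_ge0 ?ltW// -E1.
  by apply: lt_le_trans f1; rewrite ltrD2r ltr_expR ltr_pM2l.
have lt2 : s2 < cmod (hdot w' h2).
  rewrite -(@ltr_pXn2r _ 2) ?nnegrE ?cmod_ge0 ?ltW// -E2.
  by apply: lt_le_trans f2; rewrite ltrD2r ltr_expR ltr_pM2l.
have := unit_hdot_combination_le h1 h2 w'1 c10 c20; rewrite dual.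
rewrite ler_pXn2r ?nnegrE ?addr_ge0 ?mulr_ge0 ?cmod_ge0 ?(ltW s10) ?(ltW s20)//.
set x1 := cmod _ in lt1 *; set x2 := cmod _ in lt2 *.
rewrite leNgt => /negP; apply.
(* One weight may vanish; strictness is then drawn from the other. *)
have [c1z|c1p] := eqVneq c1 0.
  by rewrite c1z !mul0r !add0r ltr_pM2l//; rewrite c1z add0r in c0.
have {}c1p : 0 < c1 by rewrite lt_def c1p.
by rewrite ltr_leD ?ltr_pM2l// ler_wpM2l// ltW.
Qed.

(** The weights solve c1 A + c2 C = D s1 and c1 C + c2 B = D s2, so [v] has gains k D s1 and k D s2
    and norm k D. The free scale [k] leaves room for the factor 1 / chi of the multipliers. *)
Lemma gain_optimal_two_beams (R : realType) (M : nat)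
    (b1 b2 s1 s2 r k c1 c2 theta : R) (h1 h2 : 'cV[R[i]]_M) :
  let A := vnorm h1 ^+ 2 in let B := vnorm h2 ^+ 2 in
  let C := cmod (hdot h1 h2) in let D := A * B - C ^+ 2 in
  let v := (k * c1)%:C *: h1 + ((k * c2)%:C * expi (- theta)) *: h2 in
  0 < b1 -> 0 < b2 -> 0 < s1 -> 0 < s2 -> 0 < k ->
  0 <= c1 -> 0 <= c2 -> 0 < D ->
  c1 = B * s1 - C * s2 -> c2 = A * s2 - C * s1 -> c1 * s1 + c2 * s2 = D ->
  expR (b1 * r) - 1 = s1 ^+ 2 -> expR (b2 * r) - 1 = s2 ^+ 2 ->
  is_arg theta (hdot h1 h2) ->
  gain_optimal b1 b2 h1 h2 (((vnorm v)^-1)%:C *: v).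
Proof.
move=> A B C D v b10 b20 s10 s20 k0 c10 c20 D0 c1E c2E cD E1 E2 arg.
have a12 : hdot h1 h2 = C%:C * expi theta by [].
have a21 : hdot h2 h1 = C%:C * expi (- theta).
  by rewrite hdotC a12 [LHS]rmorphM /= conjR conj_expi.
have A11 : hdot h1 h1 = A%:C by rewrite hdotvv.
have A22 : hdot h2 h2 = B%:C by rewrite hdotvv.
have eC := expiNM theta.
have eE : Num.conj (expi (- theta)) = expi theta by rewrite conj_expi opprK.
have v1 : hdot v h1 = (k * D * s1)%:C.
  rewrite /v hdotDl !hdotZl [Num.conj (_ * _)]rmorphM /= !conjR eE A11 a21.
  have -> : (k * D * s1)%:C = (k * c1)%:C * A%:C + (k * c2)%:C * C%:C :> R[i].
    rewrite -!realCM -rmorphD /=; congr (_%:C); rewrite c1E c2E /D; ring.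
  congr (_ + _); rewrite -!mulrA; congr (_ * _).
  by rewrite mulrCA [expi _ * _]mulrC eC mulr1.
have v2 : hdot v h2 = (k * D * s2)%:C * expi theta.
  rewrite /v hdotDl !hdotZl [Num.conj (_ * _)]rmorphM /= !conjR eE A22 a12.
  have -> : (k * D * s2)%:C = (k * c1)%:C * C%:C + (k * c2)%:C * B%:C :> R[i].
    rewrite -!realCM -rmorphD /=; congr (_%:C); rewrite c1E c2E /D; ring.
  ring.
(* The left side is c1 (c1 A + c2 C) + c2 (c1 C + c2 B), that is D (c1 s1 + c2 s2). *)
have dual : c1 ^+ 2 * A + c2 ^+ 2 * B + 2 * (c1 * c2 * C) = D ^+ 2.
  transitivity (D * (c1 * s1 + c2 * s2)); last by rewrite cD expr2.
  by rewrite /D c1E c2E; ring.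
have nv : vnorm v = k * D.
  apply/eqP; rewrite -(@eqrXn2 _ 2) ?vnorm_ge0 ?mulr_ge0 ?ltW//; apply/eqP.
  rewrite /v vnorm_lin -/A -/B.
  (* The phase on [h2] cancels that of h1^H h2, so the cross term is real. *)
  rewrite [X in 2 * complex.Re X](_ : _ = (k ^+ 2 * (c1 * c2 * C))%:C).
    rewrite !cmodM !cmodR cmod_expi mulr1 !real_normK ?num_real//=.
    by rewrite [RHS]exprMn -dual; ring.
  rewrite a12 conjR !realCM -[RHS]mulr1 -eC; ring.
have kD0 : 0 < k * D by rewrite mulr_gt0.
have sc s : 0 < s -> `|(k * D)^-1| * `|k * D * s| = s.
  by move=> s0; rewrite !gtr0_norm ?invr_gt0 ?mulr_gt0// mulKf// gt_eqF.
apply: (@gain_optimal_of_dual _ _ _ _ s1 s2 c1 c2 r) => //.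
- rewrite lt_def addr_ge0// andbT; apply: contraTneq D0 => c0.
  have [z1 z2] : c1 = 0 /\ c2 = 0 by lra.
  by rewrite -cD z1 z2 !mul0r addr0 ltxx.
- by rewrite cD.
- by rewrite vnorm_normalize// nv.
- by rewrite hdotZl v1 cmodM cmod_conj !cmodR nv sc.
- by rewrite hdotZl v2 !cmodM cmod_conj !cmodR nv cmod_expi mulr1 sc.
Qed.

(** * Signs of the multipliers and the multiplier form of the beam *)

(* A negative chi would make both rho_i nonpositive, i.e. B <= delta C and
   A <= C / delta, against C^2 <= A B; then the sign of the right-hand side of
   the equation is the sign of r. *)
Lemma multiplier_signs (R : realType) (A B C b1 b2 r : R) :
  0 < A -> 0 < B -> 0 <= C -> C ^+ 2 <= A * B -> 0 < b1 -> 0 < b2 -> r != 0 ->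
  let E1 := expR (b1 * r) - 1 in let E2 := expR (b2 * r) - 1 in
  let delta := Num.sqrt (E2 / E1) in
  let rho1 := B - delta * C in let rho2 := A - delta^-1 * C in
  let chi := rho1 * b1 * expR (b1 * r) + rho2 * b2 * expR (b2 * r) in
  0 <= rho1 / chi -> 0 <= rho2 / chi -> 0 < rho1 / chi + rho2 / chi ->
  A * B - C ^+ 2 = rho2 * E2 + rho1 * E1 ->
  [/\ 0 < r, 0 <= rho1, 0 <= rho2, 0 < chi & 0 < A * B - C ^+ 2].
Proof.
move=> A0 B0 C0 CAB b10 b20 r0 E1 E2 delta rho1 rho2 chi m1 m2 m12 eqn.
have sgE b : 0 < b -> (0 < r -> 0 < expR (b * r) - 1)
    /\ (r < 0 -> expR (b * r) - 1 < 0).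
  move=> b0; split=> h.
    by rewrite subr_gt0 -expR0 ltr_expR mulr_gt0.
  by rewrite subr_lt0 -expR0 ltr_expR pmulr_rlt0.
have [E1p E1n] := sgE _ b10; have [E2p E2n] := sgE _ b20.
(* Both [E1] and [E2] carry the sign of [r], so their quotient is positive in either case. *)
have d0 : 0 < delta.
  rewrite sqrtr_gt0; have [rn|rp|r0'] := ltgtP r 0.
  - by rewrite nmulr_rgt0 ?invr_lt0 ?E1n ?E2n.
  - by rewrite divr_gt0 ?E1p ?E2p.
  - by rewrite r0' eqxx in r0.
have dV : delta * delta^-1 = 1 by rewrite divff// gt_eqF.
have e0 : 0 < delta^-1 by rewrite invr_gt0.
(* Under the convention x / 0 = 0, a vanishing [chi] would make both multipliers zero. *)
have chi_neq0 : chi != 0.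
  by apply: contraTneq m12 => ->; rewrite invr0 !mulr0 addr0 ltxx.
have chi0 : 0 < chi.
  rewrite lt_def chi_neq0 leNgt; apply/negP => chin.
  have r1 : rho1 <= 0 by move: m1; rewrite nmulr_lge0 ?invr_lt0.
  have r2 : rho2 <= 0 by move: m2; rewrite nmulr_lge0 ?invr_lt0.
  have r12 : rho1 + rho2 < 0.
    by move: m12; rewrite -mulrDl nmulr_lgt0 ?invr_lt0.
  have CC : (delta * C) * (delta^-1 * C) = C ^+ 2.
    by rewrite mulrACA dV mul1r expr2.
  move: r1 r2 r12 CC; rewrite /rho1 /rho2.
  move: (delta * C) (delta^-1 * C) => x y r1 r2 r12 CC.
  (* Here x >= B and y >= A with one inequality strict, so x y = C^2 would exceed A B. *)
  have [xB|yA] : 0 < x - B \/ 0 < y - A.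
    by case: (ltP 0 (x - B)); [left|right; lra].
    by move: CAB; rewrite -CC; nra.
  by move: CAB; rewrite -CC; nra.
have r1 : 0 <= rho1 by move: m1; rewrite pmulr_lge0 ?invr_gt0.
have r2 : 0 <= rho2 by move: m2; rewrite pmulr_lge0 ?invr_gt0.
have r12 : 0 < rho1 + rho2 by move: m12; rewrite -mulrDl pmulr_lgt0 ?invr_gt0.
have comb_gt0 u t : 0 < u -> 0 < t -> 0 < rho2 * u + rho1 * t.
  move=> u0 t0; have [p1|p2] : 0 < rho1 \/ 0 < rho2.
    case: (ltP 0 rho1) => q1; first by left.
    by right; rewrite (lt_le_trans r12)// gerDr.
  - by rewrite ltr_wpDl ?mulr_ge0 ?mulr_gt0// ltW.
  - by rewrite ltr_wpDr ?mulr_ge0 ?mulr_gt0// ltW.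
have rp : 0 < r.
  rewrite lt_def r0 leNgt; apply/negP => rn.
  have := comb_gt0 (- E2) (- E1); rewrite !oppr_gt0 E1n// E2n// => /(_ isT isT).
  by rewrite !mulrN -opprD -eqn oppr_gt0 subr_lt0 ltNge CAB.
by split => //; rewrite eqn; apply: comb_gt0; [exact: E2p|exact: E1p].
Qed.

(** Only moduli enter the constraints. This frees the sensing beam from the factor e^(-j theta) that
    the formula attaches to [h2]. *)
Lemma gain_optimal_phase (R : realType) (M : nat) (b1 b2 : R) (u : R[i])
    (h1 h2 w : 'cV[R[i]]_M) :
  cmod u = 1 -> gain_optimal b1 b2 h1 h2 w -> gain_optimal b1 b2 h1 h2 (u *: w).
Proof.
move=> u1 [r [f1 f2 w1] ub]; exists r => //.
by split; rewrite ?hdotZl ?cmodM ?cmod_conj ?vnormZ u1 mul1r.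
Qed.

Lemma normalize_phase (R : realType) (M : nat) (k : R) (u : R[i])
    (h : 'cV[R[i]]_M) : 0 < k -> cmod u = 1 ->
  ((vnorm ((k%:C * u) *: h))^-1)%:C *: ((k%:C * u) *: h)
    = u *: (((vnorm h)^-1)%:C *: h).
Proof.
move=> k0 u1; rewrite mulrC -scalerA vnormZ u1 mul1r scalerA mulrC -scalerA.
by rewrite normalize_scale.
Qed.

(** Since delta = s2 / s1, the products rho_i s_i are the weights of [gain_optimal_two_beams], taken
    with k = 1 / chi. Positivity of the roots is returned so that, when one multiplier vanishes, the
    other coefficient is known to be nonzero. *)
Lemma gain_optimal_multipliers (R : realType) (M : nat) (b1 b2 r theta : R)
    (h1 h2 : 'cV[R[i]]_M) :
  let A := vnorm h1 ^+ 2 in let B := vnorm h2 ^+ 2 in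
  let C := cmod (hdot h1 h2) in
  let E1 := expR (b1 * r) - 1 in let E2 := expR (b2 * r) - 1 in
  let delta := Num.sqrt (E2 / E1) in
  let rho1 := B - delta * C in let rho2 := A - delta^-1 * C in
  let chi := rho1 * b1 * expR (b1 * r) + rho2 * b2 * expR (b2 * r) in
  let mu1 := rho1 / chi in let mu2 := rho2 / chi in
  let v := (mu1 * Num.sqrt E1)%:C *: h1
           + ((mu2 * Num.sqrt E2)%:C * expi (- theta)) *: h2 in
  0 < b1 -> 0 < b2 -> r != 0 -> h1 != 0 -> h2 != 0 ->
  is_arg theta (hdot h1 h2) ->
  0 <= mu1 -> 0 <= mu2 -> 0 < mu1 + mu2 ->
  A * B - C ^+ 2 = rho2 * E2 + rho1 * E1 ->
  [/\ 0 < Num.sqrt E1, 0 < Num.sqrt E2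
    & gain_optimal b1 b2 h1 h2 (((vnorm v)^-1)%:C *: v)].
Proof.
move=> A B C E1 E2 delta rho1 rho2 chi mu1 mu2 v.
move=> b10 b20 r0 h10 h20 arg m1 m2 m12 eqn.
have A0 : 0 < A by rewrite exprn_gt0 ?vnorm_gt0.
have B0 : 0 < B by rewrite exprn_gt0 ?vnorm_gt0.
have C0 : 0 <= C by rewrite cmod_ge0.
have [rp r1 r2 chi0 D0] :=
  multiplier_signs A0 B0 C0 (cauchy_schwarz h1 h2) b10 b20 r0 m1 m2 m12 eqn.
have E_gt0 b : 0 < b -> 0 < expR (b * r) - 1.
  by move=> b0; rewrite subr_gt0 -expR0 ltr_expR mulr_gt0.
have E10 : 0 < E1 by exact: E_gt0.
have E20 : 0 < E2 by exact: E_gt0.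
have s10 : 0 < Num.sqrt E1 by rewrite sqrtr_gt0.
have s20 : 0 < Num.sqrt E2 by rewrite sqrtr_gt0.
have E1s : E1 = Num.sqrt E1 ^+ 2 by rewrite sqr_sqrtr ?ltW.
have E2s : E2 = Num.sqrt E2 ^+ 2 by rewrite sqr_sqrtr ?ltW.
have dE : delta = Num.sqrt E2 / Num.sqrt E1.
  by rewrite /delta sqrtrM ?ltW// sqrtrV ?ltW.
split => //.
have c1E : rho1 * Num.sqrt E1 = B * Num.sqrt E1 - C * Num.sqrt E2.
  by rewrite /rho1 dE; field; rewrite gt_eqF.
have c2E : rho2 * Num.sqrt E2 = A * Num.sqrt E2 - C * Num.sqrt E1.
  by rewrite /rho2 dE invf_div; field; rewrite gt_eqF.
have -> : v = (chi^-1 * (rho1 * Num.sqrt E1))%:C *: h1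
    + ((chi^-1 * (rho2 * Num.sqrt E2))%:C * expi (- theta)) *: h2.
  by rewrite /v /mu1 /mu2 ![_ / chi]mulrC -!mulrA.
apply: (gain_optimal_two_beams b10 b20 s10 s20 _ _ _ D0 c1E c2E _ E1s E2s arg).
- by rewrite invr_gt0.
- by rewrite mulr_ge0// ltW.
- by rewrite mulr_ge0// ltW.
- by rewrite -[RHS]/(A * B - C ^+ 2) eqn {3}E2s {3}E1s; ring.
Qed.

(** * The optimal beam for each sign pattern of the multipliers *)

Theorem theorem7 (R : realType) (M N L : nat) (p alphas : R)
    (hc hs : 'cV[R[i]]_M) (alpha Rstar theta : R)
    (p_gt0 : 0 < p) (N_gt0 : (0 < N)%N) (L_gt0 : (0 < L)%N)
    (alphas_gt0 : 0 < alphas) (hc_neq0 : hc != 0) (hs_neq0 : hs != 0)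
    (alpha_ge0 : 0 <= alpha) (alpha_le1 : alpha <= 1) :
  let beta1 := (1 - alpha) * ln 2 in
  let beta2 := L%:R * alpha * ln 2 in
  let h1 := (Num.sqrt p)%:C *: hc in
  let h2 := (Num.sqrt (p * N%:R * L%:R * alphas))%:C *: hs in
  let alpha11 := p * vnorm hc ^+ 2 in
  let alpha22 := p * N%:R * L%:R * alphas * vnorm hs ^+ 2 in
  let alpha12 := (p * Num.sqrt (N%:R * L%:R * alphas))%:C * hdot hc hs in
  let delta :=
    Num.sqrt ((expR (beta2 * Rstar) - 1) / (expR (beta1 * Rstar) - 1)) in
  let rho1 := alpha22 - delta * cmod alpha12 in
  let rho2 := alpha11 - delta^-1 * cmod alpha12 in
  let chi := rho1 * beta1 * expR (beta1 * Rstar)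
             + rho2 * beta2 * expR (beta2 * Rstar) in
  let mu1 := rho1 / chi in
  let mu2 := rho2 / chi in
  let v := (mu1 * Num.sqrt (expR (beta1 * Rstar) - 1))%:C *: h1
           + ((mu2 * Num.sqrt (expR (beta2 * Rstar) - 1))%:C * expi (- theta))
             *: h2 in
  let tau := (vnorm v)^-1 in
  let wc := ((vnorm hc)^-1)%:C *: hc in
  let ws := ((vnorm hs)^-1)%:C *: hs in
  is_arg theta alpha12 ->
  (* at Rstar = 0 the quotient in delta is 0 / 0 *)
  Rstar != 0 ->
  alpha11 * alpha22 - cmod alpha12 ^+ 2
    = (alpha11 - delta^-1 * cmod alpha12) * (expR (beta2 * Rstar) - 1)
      + (alpha22 - delta * cmod alpha12) * (expR (beta1 * Rstar) - 1) ->
  [/\ mu2 = 0 /\ 0 < mu1 -> optimal_beam N L p alphas hc hs alpha wc,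
      0 < mu1 /\ 0 < mu2 -> optimal_beam N L p alphas hc hs alpha (tau%:C *: v)
    & mu1 = 0 /\ 0 < mu2 -> optimal_beam N L p alphas hc hs alpha ws].
Proof.
move=> beta1 beta2 h1 h2 alpha11 alpha22 alpha12 delta rho1 rho2 chi mu1 mu2.
move=> v tau wc ws arg R0 eqn.
have ln2 : 0 < ln 2 :> R by rewrite ln_gt0// ltr1n.
have L0 : 0 < L%:R :> R by rewrite ltr0n.
have N0 : 0 < N%:R :> R by rewrite ltr0n.
pose q := p * N%:R * L%:R * alphas.
have q0 : 0 < q by rewrite !mulr_gt0.
have sp0 : 0 < Num.sqrt p by rewrite sqrtr_gt0.
have sq0 : 0 < Num.sqrt q by rewrite sqrtr_gt0.
have nz (k : R) (h : 'cV[R[i]]_M) : 0 < k -> h != 0 -> k%:C *: h != 0.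
  by move=> k0 h0; rewrite scaler_eq0 negb_or h0 fmorph_eq0 gt_eqF.
have h1_neq0 : h1 != 0 by exact: nz.
have h2_neq0 : h2 != 0 by exact: nz.
have sqr_norm (k : R) (h : 'cV[R[i]]_M) : 0 < k ->
    k * vnorm h ^+ 2 = vnorm ((Num.sqrt k)%:C *: h) ^+ 2.
  move=> k0; rewrite vnormZ exprMn cmodR real_normK ?num_real//.
  by rewrite (sqr_sqrtr (ltW k0)).
have a11E : alpha11 = vnorm h1 ^+ 2 by exact: sqr_norm.
have a22E : alpha22 = vnorm h2 ^+ 2 by exact: sqr_norm.
have a12E : alpha12 = hdot h1 h2.
  rewrite /h1 /h2 hdotZl hdotZr conjR mulrA -realCM; congr (_%:C * _).
  have -> : p * N%:R * L%:R * alphas = p * (N%:R * L%:R * alphas).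
    by rewrite !mulrA.
  by rewrite (sqrtrM _ (ltW p_gt0)) mulrA -expr2 (sqr_sqrtr (ltW p_gt0)).
have A0 : 0 < alpha11 by rewrite a11E exprn_gt0 ?vnorm_gt0.
have B0 : 0 < alpha22 by rewrite a22E exprn_gt0 ?vnorm_gt0.
have CAB : 0 <= alpha11 * alpha22 - cmod alpha12 ^+ 2.
  by rewrite subr_ge0 a11E a22E a12E cauchy_schwarz.
have wcE : ((vnorm h1)^-1)%:C *: h1 = wc by exact: normalize_scale.
have wsE : ((vnorm h2)^-1)%:C *: h2 = ws by exact: normalize_scale.
have to_beam w : gain_optimal beta1 beta2 h1 h2 w ->
    optimal_beam N L p alphas hc hs alpha w.
  by apply: optimal_beamP => //; exact: ltW.
have expi1 : cmod (expi (- theta)) = 1 by exact: cmod_expi.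
(* As b and [Rstar] are nonzero, the exponential differs from 1, which makes the inequality
   strict. *)
have pos_sqrtE b : b != 0 -> 0 <= expR (b * Rstar) - 1 ->
    0 < Num.sqrt (expR (b * Rstar) - 1).
  move=> b0 E0; rewrite sqrtr_gt0 lt_def E0 andbT subr_eq0 -expR0.
  by apply: contraNneq (mulf_neq0 b0 R0) => /expR_inj ->.
have [alpha0|alpha0] := eqVneq alpha 0.
  have b2E : beta2 = 0 by rewrite /beta2 alpha0 mulr0 mul0r.
  have b10 : 0 < beta1 by rewrite /beta1 alpha0 subr0 mul1r.
  have dE : delta = 0 by rewrite /delta b2E mul0r expR0 subrr mul0r sqrtr0.
  have wc_opt : gain_optimal beta1 beta2 h1 h2 wc.
    rewrite b2E -wcE; apply: gain_optimal_matched => //.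
      by apply: vnorm_normalize; exact: vnorm_gt0.
    by apply: hdot_normalize; exact: vnorm_gt0.
  split=> [_|[m1 m2]|[m1 m2]].
  - exact: to_beam.
  (* With delta = 0 and beta2 = 0 the equation reads D = alpha22 (e^(beta1 R) - 1), and D >= 0; a
     negative value would be truncated to 0 by the square root. *)
  - have E10 : 0 <= expR (beta1 * Rstar) - 1.
      move: CAB; rewrite eqn dE b2E mul0r expR0 subrr mulr0 add0r mul0r subr0.
      by rewrite pmulr_rge0.
    have k0 : 0 < mu1 * Num.sqrt (expR (beta1 * Rstar) - 1).
      by rewrite mulr_gt0// pos_sqrtE// gt_eqF.
    apply: to_beam; rewrite /tau.
    have -> : v = (mu1 * Num.sqrt (expR (beta1 * Rstar) - 1))%:C *: h1.
      rewrite /v b2E [0 * Rstar]mul0r expR0 subrr sqrtr0 mulr0 mul0r.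
      by rewrite scale0r addr0.
    by rewrite normalize_scale// wcE.
  (* This case is void: rho1 = alpha22 > 0, so mu1 = 0 forces 1 / chi = 0 and then mu2 = 0. *)
  - move: m2; rewrite /mu2; move/eqP: m1; rewrite mulf_eq0 => /orP[|/eqP->].
      by rewrite /rho1 dE mul0r subr0 gt_eqF.
    by rewrite mulr0 ltxx.
have [alpha1|alpha1] := eqVneq alpha 1.
  have b1E : beta1 = 0 by rewrite /beta1 alpha1 subrr mul0r.
  have b20 : 0 < beta2 by rewrite /beta2 alpha1 mulr1 mulr_gt0.
  (* The denominator is 0, so [delta] takes the default value 0, as does its inverse; thus rho2 =
     alpha11, the value that an infinite delta would give. *)
  have dE : delta = 0.
    by rewrite /delta b1E mul0r expR0 subrr invr0 mulr0 sqrtr0.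
  have ws_opt : gain_optimal beta1 beta2 h1 h2 ws.
    rewrite b1E -wsE; apply: gain_optimalC; apply: gain_optimal_matched => //.
      by apply: vnorm_normalize; exact: vnorm_gt0.
    by apply: hdot_normalize; exact: vnorm_gt0.
  split=> [[m2 m1]|[m1 m2]|_].
  (* Void as before, now because rho2 = alpha11 > 0. *)
  - move: m1; rewrite /mu1; move/eqP: m2; rewrite mulf_eq0 => /orP[|/eqP->].
      by rewrite /rho2 dE invr0 mul0r subr0 gt_eqF.
    by rewrite mulr0 ltxx.
  - have E20 : 0 <= expR (beta2 * Rstar) - 1.
      move: CAB; rewrite eqn dE b1E [0 * Rstar]mul0r expR0 subrr mulr0 addr0.
      by rewrite invr0 mul0r subr0 pmulr_rge0.
    have k0 : 0 < mu2 * Num.sqrt (expR (beta2 * Rstar) - 1).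
      by rewrite mulr_gt0// pos_sqrtE// gt_eqF.
    apply: to_beam; rewrite /tau.
    have -> : v = ((mu2 * Num.sqrt (expR (beta2 * Rstar) - 1))%:C
                   * expi (- theta)) *: h2.
      rewrite /v b1E [0 * Rstar]mul0r expR0 subrr sqrtr0 mulr0.
      by rewrite scale0r add0r.
    by rewrite normalize_phase// wsE; exact: gain_optimal_phase.
  - exact: to_beam.
have b10 : 0 < beta1 by rewrite mulr_gt0// subr_gt0 lt_def eq_sym alpha1.
have b20 : 0 < beta2 by rewrite !mulr_gt0// lt_def alpha0.
(* Weak signs with a positive sum cover all three cases; the single beams are the instances of [v]
   in which one coefficient is 0. *)
have main : 0 <= mu1 -> 0 <= mu2 -> 0 < mu1 + mu2 ->
    [/\ 0 < Num.sqrt (expR (beta1 * Rstar) - 1),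
        0 < Num.sqrt (expR (beta2 * Rstar) - 1)
      & gain_optimal beta1 beta2 h1 h2 (tau%:C *: v)].
  move: arg eqn; rewrite /tau /v /mu1 /mu2 /chi /rho1 /rho2 a11E a22E a12E.
  by move=> arg eqn m1 m2 m12; apply: gain_optimal_multipliers.
split=> [[m2 m1]|[m1 m2]|[m1 m2]].
- have [||s1 _] := main (ltW m1); rewrite ?m2 ?addr0// /tau.
  have -> : v = (mu1 * Num.sqrt (expR (beta1 * Rstar) - 1))%:C *: h1.
    by rewrite /v m2 mul0r mul0r scale0r addr0.
  rewrite normalize_scale; last by rewrite mulr_gt0.
  by rewrite wcE; exact: to_beam.
- have [|_ _ o] := main (ltW m1) (ltW m2); first by rewrite addr_gt0.
  exact: to_beam.
- have [|||_ s2] := main; rewrite ?m1 ?add0r ?(ltW m2)// /tau.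
  have -> : v = ((mu2 * Num.sqrt (expR (beta2 * Rstar) - 1))%:C
                 * expi (- theta)) *: h2.
    by rewrite /v m1 mul0r scale0r add0r.
  rewrite normalize_phase//; last by rewrite mulr_gt0.
  rewrite wsE => o; apply: to_beam.
  (* The normalised [v] is [ws] turned by e^(-j theta); turning it back keeps optimality. *)
  have -> : ws = expi theta *: (expi (- theta) *: ws).
    by rewrite scalerA mulrC expiNM scale1r.
  by apply: gain_optimal_phase => //; exact: cmod_expi.
Qed.
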